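(* For each integer $k\ge 2$, there exists a graph $G$ with $n_{\ge 0}(G)\le k^3+1$ and $\vartheta(G)\ge 2^k$.
   Context: $\vartheta(G)$ is the Lovász theta function: $\vartheta(G)=\max \langle J,B\rangle$ over real symmetric positive semidefinite matrices $B$ indexed by $V(G)$ with $\operatorname{tr}B=1$ and $B_{ij}=0$ for every edge $ij$, where $J$ is the all-ones matrix. A weighted adjacency matrix of a graph $G=(V,E)$ is a Hermitian matrix $A$ indexed by $V$ with $A_{ij}\neq0$ only if $ij\in E$. For a Hermitian matrix $X$, $n_{\ge 0}(X)$ is its number of nonnegative eigenvalues (with multiplicity), and $n_{\ge 0}(G)$ is the minimum of $n_{\ge 0}(A)$ over all weighted adjacency matrices $A$ of $G$. *)

(* Defs.v *)
(* over the concrete Stdlib reals R (a rcfType via Rstruct)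
   and the complex numbers R[i] = complex R (mathcomp-real-closed). *)
From Stdlib Require Reals.
From HB Require Import structures.
From mathcomp Require Import all_boot all_order all_algebra.
From mathcomp Require Import complex.
From mathcomp Require Import Rstruct.
Set Implicit Arguments. Unset Strict Implicit. Unset Printing Implicit Defensive.
Import Order.TTheory GRing.Theory Num.Theory.
Local Open Scope ring_scope.

(* The complex numbers. *)
Notation CC := (complex Rdefinitions.R).

(* A finite simple graph on vertex set 'I_n: symmetric irreflexive relation. *)
Definition simple_graph (n : nat) (e : rel 'I_n) : Prop :=
  symmetric e /\ irreflexive e.

(* ---------------- Lovász theta ---------------- *)
(* B is a feasible point of the theta SDP: real symmetric PSD, trace 1,
   B_ij = 0 for every edge ij. *)
Definition psd_real (n : nat) (B : 'M[Rdefinitions.R]_n) : Prop :=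
  B^T = B /\ forall x : 'rV[Rdefinitions.R]_n, 0 <= (x *m B *m x^T) 0 0.

Definition theta_feasible (n : nat) (e : rel 'I_n) (B : 'M[Rdefinitions.R]_n) : Prop :=
  psd_real B /\ \tr B = 1 /\ (forall i j, e i j -> B i j = 0).

(* <J, B> = sum of all entries of B *)
Definition innerJ (n : nat) (B : 'M[Rdefinitions.R]_n) : Rdefinitions.R := \sum_i \sum_j B i j.

(* [theta_is e t] : t = theta(G) = max <J,B> over feasible B
   (t is attained and is an upper bound). *)
Definition theta_is (n : nat) (e : rel 'I_n) (t : Rdefinitions.R) : Prop :=
  (exists B, theta_feasible e B /\ innerJ B = t) /\
  (forall B, theta_feasible e B -> innerJ B <= t).

(* ---------------- n_{>=0} ---------------- *)
Definition hermitian (n : nat) (A : 'M[CC]_n) : Prop :=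
  A^T = map_mx (fun z : CC => z^*) A.

(* weighted adjacency matrix: Hermitian, A_ij <> 0 only if ij is an edge *)
Definition weighted_adjacency (n : nat) (e : rel 'I_n) (A : 'M[CC]_n) : Prop :=
  hermitian A /\ (forall i j, A i j != 0 -> e i j).

(* rs is the list of eigenvalues of A with multiplicity, i.e. the roots
   (with multiplicity) of the characteristic polynomial. *)
Definition eigenvalues_mult (n : nat) (A : 'M[CC]_n) (rs : seq CC) : Prop :=
  char_poly A = \prod_(r <- rs) ('X - r%:P).

(* [n_ge0_is A m] : n_{>=0}(A) = m, the number of nonnegative eigenvalues
   counted with multiplicity (this does not depend on the ordering of rs). *)
Definition n_ge0_is (n : nat) (A : 'M[CC]_n) (m : nat) : Prop :=
  exists rs : seq CC, eigenvalues_mult A rs /\ count (fun r => 0 <= r) rs = m.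

(* [n_ge0_graph_is e m] : n_{>=0}(G) = m, the minimum of n_{>=0}(A) over
   weighted adjacency matrices A of G. *)
Definition n_ge0_graph_is (n : nat) (e : rel 'I_n) (m : nat) : Prop :=
  (exists A, weighted_adjacency e A /\ n_ge0_is A m) /\
  (forall A c, weighted_adjacency e A -> n_ge0_is A c -> (m <= c)%N).

(* Main.v *)
(* For k <= 5 the empty graph on 2^k vertices suffices. For k >= 6 put m = k^3
   and w = 2k, and join two distinct vectors of F_2^m when their Hamming distance
   is not w. The matrix with entries w - dist(u, v), u <> v, and zero diagonal is
   diagonalized by the characters of F_2^m, and only the characters of weight at
   most 1 have an eigenvalue other than - w; hence n_{>=0} <= m + 1. Averaging
   over the symmetries of the cube shows that theta = 1 + C(m, w) / kappa, where
   - kappa is the least value of the Krawtchouk polynomial K_w on {0, ..., m}.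
   Finally kappa <= C(m, w) / 2^k by the three-term recurrence
     (v + 2) K_(v+2) = s K_(v+1) - (m - v) K_v,   s = m - 2 dist:
   if s^2 >= 4 w m the ratios of successive terms stay above s / (2 v), so K_w > 0
   (for w even the sign of s is irrelevant); otherwise the recurrence gives
   |K_w| w! <= (6 w m)^(w/2), far below C(m, w) w! ~ m^w. *)
Require Import Defs.
From Stdlib Require Reals.
From HB Require Import structures.
From mathcomp Require Import all_boot all_order all_algebra.
From mathcomp Require Import complex.
From mathcomp Require Import Rstruct.
From mathcomp Require Import boolp zify ring lra.
Set Implicit Arguments. Unset Strict Implicit. Unset Printing Implicit Defensive.
Import Order.TTheory GRing.Theory Num.Theory.
Local Open Scope ring_scope.

Local Notation R := Rdefinitions.R.

(** * Bounds for solutions of the Krawtchouk three-term recurrence *)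

Section KrawtchoukRecurrence.
Variables (F : rcfType) (m w : nat) (s : F) (q : nat -> F).
Hypotheses (w_gt0 : (0 < w)%N) (w_le_m : (w <= m)%N).
Hypotheses (q0 : q 0%N = 1) (q1 : q 1%N = s).
Hypothesis qSS : forall v, (v.+2 <= w)%N ->
  v.+2%:R * q v.+2 = s * q v.+1 - (m - v)%:R * q v.

(** By induction [s * q v <= 2 * v.+1 * q v.+1]. With the bound on [s ^+ 2] this makes the
    subtracted term at most half of [s * q v.+1], so the ratio bound propagates. *)
Lemma krawtchouk_rec_gt0 :
  0 <= s -> 4 * w%:R * m%:R <= s ^+ 2 -> 0 < q w.
Proof.
move=> s_ge0 s_big.
have m_gt0 : 0 < m%:R :> F by rewrite ltr0n (leq_trans w_gt0).
have w_gt0' : 0 < w%:R :> F by rewrite ltr0n.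
have s_gt0 : 0 < s.
  rewrite lt_neqAle s_ge0 andbT; apply/eqP => s0.
  have := mulr_gt0 w_gt0' m_gt0; rewrite -s0 in s_big; nra.
suff H v : (v < w)%N -> 0 < q v /\ s * q v <= 2 * v.+1%:R * q v.+1.
  case: w w_gt0 H => // v _ /(_ v (ltnSn v)) [qv_gt0 sq].
  have sq0 : 0 < s * q v by rewrite mulr_gt0.
  have := lt_le_trans sq0 sq.
  by rewrite pmulr_rgt0 // mulr_gt0 ?ltr0n.
elim: v => [|v IHv] v_lt; first by rewrite q0 q1; split; [|lra].
have [qv_gt0 sq] := IHv (ltnW v_lt).
have qv1_gt0 : 0 < q v.+1.
  have sq0 : 0 < s * q v by rewrite mulr_gt0.
  have := lt_le_trans sq0 sq.
  by rewrite pmulr_rgt0 // mulr_gt0 ?ltr0n.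
split=> //.
rewrite -mulrA qSS //.
have mv : (m - v)%:R <= m%:R :> F by rewrite ler_nat leq_subr.
have vw : v.+1%:R <= w%:R :> F by rewrite ler_nat ltnW.
have h1 : s * ((m - v)%:R * q v) <= m%:R * (2 * v.+1%:R * q v.+1).
  rewrite mulrCA; apply: ler_pM => //; exact: mulr_ge0 (ltW _) (ltW _).
have h2 : m%:R * (4 * v.+1%:R * q v.+1) <= s ^+ 2 * q v.+1.
  rewrite mulrA ler_pM2r //; apply: le_trans s_big.
  by rewrite mulrC ler_pM2r // ler_pM2l.
have h3 : s * ((m - v)%:R * q v) *+ 2 <= s * (s * q v.+1) by lra.
rewrite -(ler_pM2l s_gt0); lra.
Qed.

(** For x_v = |q_v| v! the recurrence gives x_(v+2) <= |s| x_(v+1) + m (v+1) x_v; the hypothesis on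
    [a] is what closes the induction x_v <= a^v. *)
Lemma krawtchouk_rec_le (a : F) :
    0 <= a -> `|s| * a + m%:R * w%:R <= a ^+ 2 ->
  `|q w| * w`!%:R <= a ^+ w.
Proof.
move=> a_ge0 a_big.
have sa : `|s| <= a.
  have [//|a_lt] := leP `|s| a.
  have h1 : 0 < m%:R * w%:R :> F.
    by rewrite mulr_gt0 ?ltr0n // (leq_trans w_gt0).
  have h2 : a ^+ 2 <= `|s| * a by rewrite expr2 ler_wpM2r // ltW.
  lra.
suff H v : (v < w)%N ->
    `|q v| * v`!%:R <= a ^+ v /\ `|q v.+1| * v.+1`!%:R <= a ^+ v.+1.
  by case: w w_gt0 H => // v _ /(_ v (ltnSn v)) [].
elim: v => [|v IHv] v_lt; first by rewrite q0 q1 normr1 !mulr1 expr0 expr1.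
have [qv qv1] := IHv (ltnW v_lt); split=> //.
rewrite factS natrM mulrA.
have -> : `|q v.+2| * v.+2%:R = `|s * q v.+1 - (m - v)%:R * q v|.
  by rewrite -qSS // normrM normr_nat mulrC.
apply: (@le_trans _ _ ((`|s| * `|q v.+1| + m%:R * `|q v|) * v.+1`!%:R)).
  rewrite ler_wpM2r ?ler0n //; apply: le_trans (ler_normB _ _) _.
  rewrite !normrM normr_nat lerD2l ler_wpM2r ?normr_ge0 //.
  by rewrite ler_nat leq_subr.
have b1 : `|s| * (`|q v.+1| * v.+1`!%:R) <= `|s| * a ^+ v.+1.
  by rewrite ler_wpM2l.
have b2 : m%:R * v.+1%:R * (`|q v| * v`!%:R) <= m%:R * w%:R * a ^+ v.
  apply: ler_pM => //; rewrite ?mulr_ge0 ?ler0n //.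
  by rewrite ler_wpM2l ?ler0n // ler_nat ltnW.
have b3 : (`|s| * a + m%:R * w%:R) * a ^+ v <= a ^+ 2 * a ^+ v.
  by rewrite ler_wpM2r // exprn_ge0.
rewrite -exprD add2n in b3.
rewrite [leLHS](_ : _ = `|s| * (`|q v.+1| * v.+1`!%:R) +
  m%:R * v.+1%:R * (`|q v| * v`!%:R)); last by rewrite [in LHS]factS natrM; ring.
apply: le_trans (lerD b1 b2) _; rewrite [a ^+ v.+1]exprS; lra.
Qed.

End KrawtchoukRecurrence.

(** The two previous bounds, with w = 2h, cover the ranges s^2 >= 8hm and s^2 < 8hm. *)
Lemma krawtchouk_rec_ge (F : rcfType) (m h : nat) (s : F) (q : nat -> F) :
    (0 < h)%N -> (2 * h <= m)%N -> q 0%N = 1 -> q 1%N = s ->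
    (forall v, (v.+2 <= 2 * h)%N ->
      v.+2%:R * q v.+2 = s * q v.+1 - (m - v)%:R * q v) ->
  - (12 * h%:R * m%:R) ^+ h <= q (2 * h)%N * (2 * h)`!%:R.
Proof.
move=> h_gt0 h_le_m.
(* Replacing [s] by [- s] and [q v] by [(-1) ^+ v * q v] preserves the recurrence and the value at
   the even index 2h. *)
wlog s_ge0 : s q / 0 <= s => [wlog_s q0 q1 qSS|].
  have [s_ge0|/ltW s_le0] := leP 0 s; first exact: (wlog_s s).
  have := wlog_s (- s) (fun v => (-1) ^+ v * q v); cbv beta.
  rewrite q0 q1 oppr_ge0 expr0 expr1 mulr1 mulN1r exprM sqrrN !expr1n mul1r.
  apply=> // v /qSS H.
  by rewrite !exprS mulrCA H; ring.
move=> q0 q1 qSS.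
have w_gt0 : (0 < 2 * h)%N by rewrite muln_gt0.
have hF : 0 < h%:R :> F by rewrite ltr0n.
have mF : 0 < m%:R :> F by rewrite ltr0n (leq_trans w_gt0).
have hmF : 0 < h%:R * m%:R :> F by rewrite mulr_gt0.
have [s_big|s_small] := leP (4 * (2 * h)%:R * m%:R) (s ^+ 2).
  have qw := krawtchouk_rec_gt0 w_gt0 h_le_m q0 q1 qSS s_ge0 s_big.
  apply: (@le_trans _ _ 0); last by rewrite mulr_ge0 ?ler0n // ltW.
  rewrite oppr_le0 exprn_ge0 // -mulrA; lra.
(* 12 = 10 + 2: the bound on [|s| * a] takes 10hm, and m w = 2hm takes the rest. *)
pose a := Num.sqrt (12 * h%:R * m%:R : F).
have a2 : a ^+ 2 = 12 * h%:R * m%:R by rewrite sqr_sqrtr // -mulrA; lra.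
have a_ge0 : 0 <= a := sqrtr_ge0 _.
(* (|s| a)^2 < 8hm * 12hm < (10hm)^2 *)
have sa : `|s| * a <= 10 * (h%:R * m%:R).
  rewrite -ler_sqr ?nnegrE ?mulr_ge0 //.
  rewrite exprMn a2 ger0_norm // expr2 in s_small *.
  move: s_small hmF; rewrite natrM; nra.
have qa : `|q (2 * h)%N| * (2 * h)`!%:R <= (12 * h%:R * m%:R) ^+ h.
  rewrite -a2 -exprM; apply: (krawtchouk_rec_le w_gt0 h_le_m q0 q1 qSS) => //.
  rewrite a2 natrM; move: sa; lra.
have := ler0n F (2 * h)`!; have := lerNnormlW (lexx `|q (2 * h)%N|).
move: qa; nra.
Qed.

(** * Subsets of [T] as vectors over F_2 *)

Section SymmetricDifference.
Variable T : finType.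
Implicit Types (i : T) (A B : {set T}).

(** Addition in F_2^T; its cardinality is the Hamming distance. *)
Definition symdiff A B := (A :\: B) :|: (B :\: A).

Lemma in_symdiff i A B : (i \in symdiff A B) = (i \in A) (+) (i \in B).
Proof. by rewrite !inE; case: (i \in A); case: (i \in B). Qed.

Lemma symdiffC A B : symdiff A B = symdiff B A.
Proof. by apply/setP=> i; rewrite !in_symdiff addbC. Qed.

Lemma symdiffK A : involutive (symdiff A).
Proof. by move=> B; apply/setP=> i; rewrite !in_symdiff addKb. Qed.

Lemma symdiff_eq0 A B : (symdiff A B == set0) = (A == B).
Proof.
apply/eqP/eqP => [/setP AB|->].
  by apply/setP=> i; have:= AB i; rewrite in_symdiff inE => /negbT; rewrite negb_add => /eqP.
by apply/setP=> i; rewrite in_symdiff addbb inE.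
Qed.

Lemma card_symdiff1 i A :
  #|symdiff [set i] A| = if i \in A then #|A|.-1 else #|A|.+1.
Proof.
case: ifPn => iA.
  rewrite [in RHS](cardsD1 i) iA; apply: eq_card => j.
  by rewrite in_symdiff !inE; case: eqVneq => [->|]; rewrite ?iA.
rewrite -add1n -[1%N]/(nat_of_bool true) -iA -cardsU1; apply: eq_card => j.
by rewrite in_symdiff !inE; case: eqVneq => [->|]; rewrite ?(negPf iA).
Qed.

End SymmetricDifference.

(** * Characters of F_2^T and Krawtchouk polynomials *)

Section Characters.
Variables (F : numFieldType) (T : finType).
Implicit Types (i : T) (A B J z : {set T}).

(** The character (-1)^|J :&: z|, as a product so that identities reduce to single coordinates. *)
Definition chi J z : F := \prod_i (-1) ^+ ((i \in J) && (i \in z)).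

Lemma chiC J z : chi J z = chi z J.
Proof. by apply: eq_bigr => i _; rewrite andbC. Qed.

Lemma chi0 z : chi set0 z = 1.
Proof. by apply: big1 => i _; rewrite inE. Qed.

Lemma chi_symdiff J A B : chi J (symdiff A B) = chi J A * chi J B.
Proof.
rewrite -big_split /=; apply: eq_bigr => i _.
by rewrite in_symdiff; case: (i \in J); rewrite ?signr_addb ?mulr1.
Qed.

Lemma chi1 i z : chi [set i] z = (-1) ^+ (i \in z).
Proof.
rewrite /chi (bigD1 i) //= !inE eqxx big1 ?mulr1 // => j ji.
by rewrite inE (negPf ji).
Qed.

Lemma sum_chi1 z : \sum_i chi [set i] z = #|T|%:R - 2 * #|z|%:R.
Proof.
have H i : chi [set i] z = 1 - 2 * (i \in z)%:R.
  by rewrite chi1; case: (i \in z); rewrite ?expr0 ?expr1 /=; ring.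
rewrite (eq_bigr _ (fun i _ => H i)) sumrB sumr_const -mulr_sumr -natr_sum.
congr (_ - 2 * _%:R); rewrite -sum1_card [RHS]big_mkcond.
by apply: eq_bigr => i _; case: (i \in z).
Qed.

Lemma sum_chi z : \sum_J chi J z = (2 ^ #|T|)%:R * (z == set0)%:R.
Proof.
have [->|/set0Pn[i iz]] := eqVneq z set0.
  under eq_bigr do rewrite chiC chi0.
  by rewrite sumr_const mulr1 -cardsT -card_powerset powersetT cardsT.
rewrite mulr0; set S := (LHS).
have SN : S = - S.
  rewrite {1}/S (reindex_inj (can_inj (symdiffK [set i]))) -sumrN.
  apply: eq_bigr => J _.
  by rewrite chiC chi_symdiff chiC chi1 iz expr1 mulN1r chiC.
by apply/eqP; rewrite -[_ == 0](mulrn_eq0 S 2) mulr2n {1}SN addNr.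
Qed.

(** The Krawtchouk polynomial K_v at the weight of [z]; that only the weight matters is
    [eq_krawtchouk]. *)
Definition krawtchouk v z : F := \sum_(J : {set T} | #|J| == v) chi J z.

Lemma krawtchouk0 z : krawtchouk 0 z = 1.
Proof.
rewrite /krawtchouk (bigD1 set0) ?cards0 //= chi0 big1 ?addr0 // => J.
by rewrite cards_eq0 => /andP[->].
Qed.

Lemma krawtchouk_set0 v : krawtchouk v set0 = 'C(#|T|, v)%:R.
Proof.
rewrite /krawtchouk -card_draws -sum1dep_card natr_sum.
by apply: eq_big => J; rewrite ?inE // chiC chi0.
Qed.

(* Symmetric difference with [set i] sends the v-sets to the (v+1)-sets
   containing i and the (v-1)-sets avoiding i. *)
Lemma krawtchouk_shift v z :
  (#|T|%:R - 2 * #|z|%:R) * krawtchouk v z =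
  v.+1%:R * krawtchouk v.+1 z +
  \sum_(J : {set T} | #|J|.+1 == v) (#|T| - #|J|)%:R * chi J z.
Proof.
rewrite -sum_chi1 mulr_suml.
transitivity (\sum_i \sum_(J : {set T}) ((i \in J) && (#|J| == v.+1))%:R * chi J z +
              \sum_i \sum_(J : {set T}) ((i \notin J) && (#|J|.+1 == v))%:R * chi J z).
  rewrite -big_split /=; apply: eq_bigr => i _; rewrite -big_split /=.
  rewrite mulr_sumr big_mkcond (reindex_inj (can_inj (symdiffK [set i]))) /=.
  apply: eq_bigr => J _; rewrite card_symdiff1.
  rewrite (chiC (symdiff _ _)) chi_symdiff !(chiC z) mulrA chi1 -expr2 sqrr_sign.
  rewrite mul1r; case: (boolP (i \in J)) => iJ /=; rewrite ?mul0r ?addr0 ?add0r.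
    rewrite -[#|J|]prednK ?eqSS; last by apply/card_gt0P; exists i.
    by case: eqP; rewrite ?mul1r ?mul0r.
  by case: eqP; rewrite ?mul1r ?mul0r.
congr (_ + _); rewrite exchange_big /=.
  rewrite mulr_sumr [RHS]big_mkcond; apply: eq_bigr => J _.
  rewrite -mulr_suml -natr_sum; case: eqP => [<-|_]; last first.
    by rewrite big1 ?mul0r // => i _; rewrite andbF.
  rewrite -[in RHS]sum1_card [in RHS]big_mkcond.
  by under eq_bigr do rewrite andbT.
rewrite [RHS]big_mkcond; apply: eq_bigr => J _.
rewrite -mulr_suml -natr_sum; case: eqP => _; last first.
  by rewrite big1 ?mul0r // => i _; rewrite andbF.
rewrite -cardsT -cardsDS ?subsetT // -sum1_card [in RHS]big_mkcond.
by congr (_%:R * _); apply: eq_bigr => i _; rewrite !inE andbT; case: (i \in J).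
Qed.

Lemma krawtchouk1 z : krawtchouk 1 z = #|T|%:R - 2 * #|z|%:R.
Proof.
by have := krawtchouk_shift 0 z; rewrite krawtchouk0 mulr1 mul1r big_pred0 ?addr0.
Qed.

Lemma krawtchoukSS v z :
  v.+2%:R * krawtchouk v.+2 z =
  (#|T|%:R - 2 * #|z|%:R) * krawtchouk v.+1 z - (#|T| - v)%:R * krawtchouk v z.
Proof.
rewrite krawtchouk_shift; apply/eqP; rewrite eq_sym subr_eq; apply/eqP.
congr (_ + _); rewrite mulr_sumr; apply: eq_bigr => J.
by rewrite eqSS => /eqP->.
Qed.

(** The recurrence determines every K_v from K_0 and K_1, which see only the weight. *)
Lemma eq_krawtchouk v z z' : #|z| = #|z'| -> krawtchouk v z = krawtchouk v z'.
Proof.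
move=> zz'; suff [] : krawtchouk v z = krawtchouk v z' /\
  krawtchouk v.+1 z = krawtchouk v.+1 z' by [].
elim: v => [|v [IH0 IH1]]; first by rewrite !krawtchouk0 !krawtchouk1 zz'.
split=> //; apply: (@mulfI _ v.+2%:R); first by rewrite pnatr_eq0.
by rewrite !krawtchoukSS IH0 IH1 zz'.
Qed.

Lemma sum_krawtchouk v : (0 < v)%N -> \sum_(J : {set T}) krawtchouk v J = 0.
Proof.
move=> v_gt0; rewrite exchange_big big1 //= => J /eqP cJ.
under eq_bigr do rewrite chiC.
by rewrite sum_chi -cards_eq0 cJ gtn_eqF // mulr0.
Qed.

(** Both sides are the sum of [chi B C] over all pairs of sets of the two given sizes. *)
Lemma krawtchouk_reciprocity J z :
  'C(#|T|, #|z|)%:R * krawtchouk #|J| z = 'C(#|T|, #|J|)%:R * krawtchouk #|z| J.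
Proof.
have H j (A : {set T}) :
  'C(#|T|, #|A|)%:R * krawtchouk j A = \sum_(B : {set T} | #|B| == #|A|) krawtchouk j B.
  rewrite -card_draws -sum1dep_card natr_sum mulr_suml.
  by apply: eq_big => [B|B]; rewrite ?inE // mul1r => /eqP/eq_krawtchouk.
rewrite !H /krawtchouk exchange_big /=; apply: eq_bigr => B _.
by apply: eq_bigr => C _; rewrite chiC.
Qed.

(** Fourier inversion: K_v is the transform of the indicator of the sphere of radius [v]. *)
Lemma sum_krawtchouk_chi v z :
  \sum_(J : {set T}) krawtchouk v J * chi J z = (2 ^ #|T|)%:R * (#|z| == v)%:R.
Proof.
transitivity (\sum_(A : {set T} | #|A| == v) \sum_J chi J (symdiff A z)).
  rewrite exchange_big /=; apply: eq_bigr => J _; rewrite mulr_suml.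
  by apply: eq_bigr => A _; rewrite chi_symdiff (chiC A).
under eq_bigr do rewrite sum_chi symdiff_eq0.
rewrite -mulr_sumr; congr (_ * _).
case: eqP => [zv|zv].
  rewrite (bigD1 z) ?zv //= eqxx big1 ?addr0 // => A /andP[_ Az].
  by rewrite (negPf Az).
rewrite big1 // => A /eqP Av; case: eqVneq => // Az; by rewrite -Az Av in zv.
Qed.

End Characters.

(** * Spectra of diagonalized matrices and existence of the minimum *)

Lemma char_poly_diagonalized (F : fieldType) n (A P : 'M[F]_n) (d : 'rV[F]_n) :
    P \in unitmx -> A *m P = P *m diag_mx d ->
  char_poly A = \prod_i ('X - (d 0 i)%:P).
Proof.
move=> P_unit AP; pose PX : 'M[{poly F}]_n := map_mx polyC P.
have detPX : \det PX != 0.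
  by rewrite det_map_mx polyC_eq0 -unitfE -unitmxE.
have <- : char_poly (diag_mx d) = \prod_i ('X - (d 0 i)%:P).
  rewrite char_poly_trig ?diag_mx_is_trig //.
  by apply: eq_bigr => i _; rewrite mxE eqxx mulr1n.
(* Over polynomials (X - A) P = P (X - D); take determinants and cancel det P. *)
apply: (mulIf detPX); rewrite [RHS]mulrC -!det_mulmx.
congr (\det _); rewrite mulmxBl mulmxBr -!map_mxM AP.
by rewrite scalar_mxC.
Qed.

Lemma big_ord_enum_val (V : Type) (idx : V) {op : Monoid.com_law idx}
    (I : finType) (f : I -> V) :
  \big[op/idx]_(i < #|I|) f (enum_val i) = \big[op/idx]_x f x.
Proof.
rewrite [RHS](reindex (fun i : 'I_#|I| => enum_val i)) //.
exact/onW_bij/enum_val_bij.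
Qed.

(** The counts are natural numbers, so well-ordering yields the minimum; the predicate is made
    boolean classically. *)
Lemma n_ge0_graph_exists n (e : rel 'I_n) (A : 'M[CC]_n) c :
    weighted_adjacency e A -> n_ge0_is A c ->
  exists m, n_ge0_graph_is e m /\ (m <= c)%N.
Proof.
pose P m := exists B, weighted_adjacency e B /\ n_ge0_is B m.
move=> Ae Ac; have exP : exists m, `[<P m>] by exists c; apply/asboolP; exists A.
case: (ex_minnP exP) => m /asboolP Pm m_min; exists m.
split; last by apply: m_min; apply/asboolP; exists A.
by split=> // B d Be Bd; apply: m_min; apply/asboolP; exists B.
Qed.

(** * Positive semidefinite forms and the empty graph *)

Lemma quad_formE n (B : 'M[R]_n) (x : 'rV[R]_n) :
  (x *m B *m x^T) 0 0 = \sum_i \sum_j x 0 i * B i j * x 0 j.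
Proof.
rewrite mxE exchange_big /=; apply: eq_bigr => j _.
by rewrite !mxE mulr_suml.
Qed.

(** The quadratic form becomes a nonnegative combination of squares. *)
Lemma psd_real_sum n (I : finType) (c : I -> R) (f : I -> 'I_n -> R)
    (B : 'M[R]_n) :
    (forall a, 0 <= c a) -> (forall i j, B i j = \sum_a c a * f a i * f a j) ->
  psd_real B.
Proof.
move=> c_ge0 BE; split.
  by apply/matrixP=> i j; rewrite mxE !BE; apply: eq_bigr => a _; rewrite mulrAC.
move=> x; rewrite quad_formE.
suff -> : \sum_i \sum_j x 0 i * B i j * x 0 j =
          \sum_a c a * (\sum_i x 0 i * f a i) ^+ 2.
  by apply: sumr_ge0 => a _; rewrite mulr_ge0 ?sqr_ge0.
transitivity (\sum_i \sum_j \sum_a c a * ((x 0 i * f a i) * (x 0 j * f a j))).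
  apply: eq_bigr => i _; apply: eq_bigr => j _.
  rewrite BE mulr_sumr mulr_suml; apply: eq_bigr => a _; ring.
under eq_bigr do rewrite exchange_big /=.
rewrite exchange_big /=; apply: eq_bigr => a _.
rewrite expr2 mulr_suml mulr_sumr; apply: eq_bigr => i _.
by rewrite !mulr_sumr.
Qed.

(** The matrix J/n attains the value. For the upper bound, the form at e_i - e_j, summed over all
    pairs, gives 2n tr B - 2 <J,B> >= 0. *)
Lemma theta_empty_graph n : (0 < n)%N -> @theta_is n (fun _ _ => false) n%:R.
Proof.
move=> n_gt0; have nR : n%:R != 0 :> R by rewrite pnatr_eq0 -lt0n.
split=> [|B [[_ B_psd] [trB _]]].
  exists (const_mx n%:R^-1); split; first split.
  - apply: (@psd_real_sum _ unit (fun _ => n%:R^-1) (fun _ _ => 1)) => [_|i j].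
      by rewrite invr_ge0 ler0n.
    rewrite mxE (eq_bigr (fun _ => n%:R^-1)) ?sumr_const ?card_unit //.
    by move=> ? _; rewrite !mulr1.
  - split=> //; rewrite /mxtrace (eq_bigr (fun _ => n%:R^-1)) => [|i _].
      by rewrite sumr_const card_ord -[LHS]mulr_natr mulVf.
    by rewrite mxE.
  - rewrite /innerJ (eq_bigr (fun _ => 1)) ?sumr_const ?card_ord // => i _.
    rewrite (eq_bigr (fun _ => n%:R^-1)) ?sumr_const ?card_ord => [|j _].
      by rewrite -[LHS]mulr_natr mulVf.
    by rewrite mxE.
have pair_ge0 i j : 0 <= B i i + B j j - B i j - B j i.
  have := B_psd (delta_mx 0 i - delta_mx 0 j).
  rewrite [X in _ - X]/(delta_mx 0 j) mulmxBl linearB /= mulmxBr !mulmxBl.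
  rewrite -!rowE !trmx_delta -!colE !mxE; lra.
have : 0 <= \sum_i \sum_j (B i i + B j j - B i j - B j i).
  by apply: sumr_ge0 => i _; apply: sumr_ge0.
suff -> : \sum_i \sum_j (B i i + B j j - B i j - B j i) =
          n%:R * \tr B + n%:R * \tr B - innerJ B - innerJ B.
  by rewrite trB; lra.
have sB : innerJ B = \sum_i \sum_j B j i by rewrite /innerJ exchange_big.
rewrite {2}sB /innerJ.
under eq_bigr do rewrite !sumrB big_split /=.
rewrite !sumrB big_split /=; congr (_ + _ - _ - _).
  rewrite mulr_sumr; apply: eq_bigr => i _.
  by rewrite sumr_const card_ord mulr_natl.
by rewrite sumr_const card_ord mulr_natl.
Qed.

Lemma n_ge0_empty_graph n :
  exists m, @n_ge0_graph_is n (fun _ _ => false) m /\ (m <= n)%N.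
Proof.
have A0 : @weighted_adjacency n (fun _ _ => false) 0.
  split=> [|i j]; last by rewrite mxE eqxx.
  by apply/matrixP=> i j; rewrite !mxE conjC0.
have [rs] := closed_field_poly_normal (char_poly (0 : 'M[CC]_n)).
rewrite (monicP (char_poly_monic _)) scale1r => rsE.
have [|m [mP m_le]] := n_ge0_graph_exists A0
  (c := count (fun r : CC => 0 <= r) rs); first by exists rs.
exists m; split=> //; apply: leq_trans m_le (leq_trans (count_size _ _) _).
by rewrite -ltnS -(size_prod_XsubC rs id) -rsE size_char_poly.
Qed.

(** * Theta and the spectrum of the distance graph *)

Section DistanceGraph.
Variables (T : finType) (w : nat).
Hypothesis w_gt0 : (0 < w)%N.
Let V := {set T}.
Let vtx (i : 'I_#|V|) : V := enum_val i.
Let dist i j := #|symdiff (vtx i) (vtx j)|.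

Definition distance_graph : rel 'I_#|{set T}| :=
  fun i j => (i != j) && (#|symdiff (enum_val i) (enum_val j)| != w).

Lemma distance_graph_simple : simple_graph distance_graph.
Proof.
split=> [i j|i]; last by rewrite /distance_graph eqxx.
by rewrite /distance_graph eq_sym symdiffC.
Qed.

Let card_V : #|V| = (2 ^ #|T|)%N.
Proof. by have := card_powerset [set: T]; rewrite powersetT !cardsT. Qed.

Let dist_eq0 i j : (dist i j == 0%N) = (i == j).
Proof. by rewrite cards_eq0 symdiff_eq0 (inj_eq enum_val_inj). Qed.

Let sum_chiM (F : numFieldType) i j :
  \sum_J chi F J (vtx i) * chi F J (vtx j) = #|V|%:R * (i == j)%:R.
Proof.
under eq_bigr do rewrite -chi_symdiff.
by rewrite sum_chi -card_V symdiff_eq0 (inj_eq enum_val_inj).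
Qed.

Lemma theta_distance_graph (J0 : V) (kappa : R) :
    (w <= #|T|)%N -> 0 < kappa -> krawtchouk R w J0 = - kappa ->
    (forall J : V, - kappa <= krawtchouk R w J) ->
  theta_is distance_graph (1 + 'C(#|T|, w)%:R / kappa).
Proof.
move=> w_le kappa_gt0 KJ0 K_ge.
have kappa_neq0 : kappa != 0 by rewrite gt_eqF.
have b_gt0 : 0 < 'C(#|T|, w)%:R :> R by rewrite ltr0n bin_gt0.
have N_gt0 : 0 < #|V|%:R :> R by rewrite ltr0n card_V expn_gt0.
have N_neq0 : #|V|%:R != 0 :> R by rewrite gt_eqF.
split=> [|B [[_ B_psd] [trB B0]]].
  (* The characters are eigenvectors, with eigenvalues (1 + K_w(J) / kappa) / |V|, nonnegative
     because - kappa bounds K_w from below. *)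
  pose B : 'M[R]_#|V| := \matrix_(i, j)
    (#|V|%:R^-1 * ((i == j)%:R + kappa^-1 * (dist i j == w)%:R)).
  have Bii i : B i i = #|V|%:R^-1.
    by rewrite mxE (eqP (_ : dist i i == 0%N)) ?dist_eq0 // eqxx ltn_eqF // mulr0 addr0 mulr1.
  exists B; split; first split.
  - apply: (@psd_real_sum _ V
      (fun J => #|V|%:R^-1 ^+ 2 * (1 + kappa^-1 * krawtchouk R w J))
      (fun J i => chi R J (vtx i))) => [J|i j].
      rewrite mulr_ge0 ?sqr_ge0 // -(mulVf kappa_neq0) -mulrDr mulr_ge0 //.
        by rewrite invr_ge0 ltW.
      by have := K_ge J; lra.
    transitivity (#|V|%:R^-1 ^+ 2 * (\sum_J chi R J (vtx i) * chi R J (vtx j) +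
      kappa^-1 * \sum_J krawtchouk R w J * chi R J (symdiff (vtx i) (vtx j)))).
      rewrite sum_chiM sum_krawtchouk_chi -card_V mxE /dist; field.
      by rewrite kappa_neq0.
    rewrite mulr_sumr -big_split mulr_sumr; apply: eq_bigr => J _ /=.
    rewrite chi_symdiff; ring.
  - split=> [|i j /andP[ij dij]].
      rewrite /mxtrace (eq_bigr _ (fun i _ => Bii i)) sumr_const card_ord.
      by rewrite -[LHS]mulr_natr mulVf.
    by rewrite mxE (negPf ij) (negPf dij) mulr0 addr0 mulr0.
  - rewrite /innerJ (eq_bigr (fun _ => #|V|%:R^-1 * (1 + 'C(#|T|, w)%:R / kappa))).
      rewrite sumr_const card_ord -[LHS]mulr_natr; field.
      by rewrite kappa_neq0.
    move=> i _; under eq_bigr do rewrite mxE.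
    rewrite -mulr_sumr big_split /= -mulr_sumr; congr (_ * (_ + _)).
      by rewrite (bigD1 i) //= eqxx big1 ?addr0 // => j; rewrite eq_sym => /negPf->.
    rewrite mulrC; congr (_ / _).
    rewrite (big_ord_enum_val (fun A : V => (#|symdiff (vtx i) A| == w)%:R)).
    rewrite (reindex_inj (can_inj (symdiffK (vtx i)))) /=.
    under eq_bigr do rewrite symdiffK.
    by rewrite -natr_sum -card_draws -sum1dep_card [in RHS]big_mkcond.
(* Upper bound: add the values of the form at all characters of weight [j0]. This replaces averaging
   over the symmetries of the cube. *)
pose j0 := #|J0|; pose c : R := 'C(#|T|, j0)%:R.
have c_gt0 : 0 < c by rewrite ltr0n bin_gt0 max_card.
have : 0 <= \sum_(J : V | #|J| == j0)
    \sum_i \sum_j chi R J (vtx i) * B i j * chi R J (vtx j).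
  apply: sumr_ge0 => J _; have := B_psd (\row_i chi R J (vtx i)).
  rewrite quad_formE; congr (_ <= _); apply: eq_bigr => i _.
  by apply: eq_bigr => j _; rewrite !mxE.
suff -> : \sum_(J : V | #|J| == j0)
    \sum_i \sum_j chi R J (vtx i) * B i j * chi R J (vtx j) =
  c * ((1 + kappa / 'C(#|T|, w)%:R) * \tr B - kappa / 'C(#|T|, w)%:R * innerJ B).
  rewrite pmulr_rge0 // trB mulr1 subr_ge0 => H.
  have kb : 0 < kappa / 'C(#|T|, w)%:R by rewrite divr_gt0.
  rewrite -(ler_pM2l kb); apply: le_trans H _; rewrite le_eqVlt.
  by apply/orP; left; apply/eqP; field; rewrite kappa_neq0 gt_eqF.
(* Off the diagonal [B] survives only at distance [w], where reciprocity turns K_(j0) into - c kappa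
   / C(m, w); on the diagonal it is [c]. *)
have BE i j : B i j * krawtchouk R j0 (symdiff (vtx i) (vtx j)) =
  c * ((1 + kappa / 'C(#|T|, w)%:R) * (B i j * (i == j)%:R) -
       kappa / 'C(#|T|, w)%:R * B i j).
  have [ij|ij] := eqVneq i j.
    have -> : symdiff (vtx i) (vtx j) = set0.
      by apply/eqP; rewrite symdiff_eq0 ij.
    by rewrite krawtchouk_set0 -/c !mulr1; ring.
  have [dw|dw] := eqVneq (dist i j) w; last first.
    by rewrite B0 ?/distance_graph ?ij //; ring.
  have := krawtchouk_reciprocity R J0 (symdiff (vtx i) (vtx j)).
  rewrite [#|symdiff _ _|]dw KJ0 -/j0 -/c => rec.
  have -> : krawtchouk R j0 (symdiff (vtx i) (vtx j)) =
    c * - kappa / 'C(#|T|, w)%:R.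
    by rewrite -rec mulrC mulKf // gt_eqF.
  by rewrite /= !mulr0 sub0r; ring.
transitivity (\sum_i \sum_j B i j * krawtchouk R j0 (symdiff (vtx i) (vtx j))).
  rewrite exchange_big; apply: eq_bigr => i _.
  rewrite exchange_big; apply: eq_bigr => j _.
  rewrite mulr_sumr; apply: eq_bigr => J _.
  by rewrite chi_symdiff; ring.
under eq_bigr do under eq_bigr do rewrite BE.
under eq_bigr do rewrite -mulr_sumr sumrB -!mulr_sumr.
rewrite -mulr_sumr sumrB -!mulr_sumr; congr (_ * (_ * _ - _)).
apply: eq_bigr => i _; rewrite (bigD1 i) //= eqxx mulr1 big1 ?addr0 // => j.
by rewrite eq_sym => /negPf->; rewrite mulr0.
Qed.

(* [w - dist] has rank [#|T| + 1]: it is a combination of the trivial character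
   and the characters of the singletons. Subtracting [w] from the diagonal
   moves all its other eigenvalues to [- w]. *)
Lemma n_ge0_distance_graph :
  exists m, n_ge0_graph_is distance_graph m /\ (m <= #|T|.+1)%N.
Proof.
pose A : 'M[CC]_#|V| := \matrix_(i, j) (if i == j then 0 else w%:R - (dist i j)%:R).
have N_neq0 : #|V|%:R != 0 :> CC by rewrite pnatr_eq0 card_V -lt0n expn_gt0.
have Ae : weighted_adjacency distance_graph A.
  split=> [|i j].
    apply/matrixP=> i j; rewrite !mxE eq_sym /dist symdiffC.
    by case: eqP => _; rewrite ?conjC0 // rmorphB /= !conjC_nat.
  rewrite mxE /distance_graph; case: (eqVneq i j) => _; first by rewrite eqxx.
  by rewrite subr_eq0 eqr_nat eq_sym.
(* Since dist = (m - K_1) / 2, w - dist = (w - m/2) + K_1 / 2; the last term removes [w] from the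
   diagonal by orthogonality. The eigenvalues are |V| d(J). *)
pose d (J : V) : CC := (J == set0)%:R * (w%:R - #|T|%:R / 2) +
  (#|J| == 1%N)%:R / 2 - w%:R / #|V|%:R.
have AE i j : A i j = \sum_J d J * (chi CC J (vtx i) * chi CC J (vtx j)).
  transitivity ((w%:R - #|T|%:R / 2) +
    krawtchouk CC 1 (symdiff (vtx i) (vtx j)) / 2 -
    w%:R / #|V|%:R * \sum_J chi CC J (vtx i) * chi CC J (vtx j)).
    rewrite krawtchouk1 sum_chiM mxE -/(dist i j); case: (eqVneq i j) => [ij|ij].
      by rewrite (eqP (_ : dist i j == 0%N)) ?dist_eq0 ?ij // mulr1; field.
    by rewrite !mulr0; field.
  rewrite /krawtchouk mulr_suml mulr_sumr -sumrN.
  rewrite [X in _ + X + _]big_mkcond -addrA -big_split /=.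
  rewrite (bigD1 set0) //= [RHS](bigD1 set0) //= addrA; congr (_ + _).
    by rewrite /d eqxx cards0 !chi0 /= mulr1n; ring.
  apply: eq_bigr => J /negPf J0; rewrite /d J0 chi_symdiff.
  by case: eqP => _ /=; rewrite ?mulr1n ?mulr0n; ring.
pose P : 'M[CC]_#|V| := \matrix_(i, j) chi CC (vtx j) (vtx i).
have PPT : P *m P^T = #|V|%:R%:M.
  apply/matrixP=> i j; rewrite !mxE.
  transitivity (#|V|%:R * (i == j)%:R : CC); last by rewrite mulr_natr.
  rewrite -sum_chiM.
  rewrite -(big_ord_enum_val (fun J => chi CC J (vtx i) * chi CC J (vtx j))).
  by apply: eq_bigr => J _; rewrite !mxE.
have P_unit : P \in unitmx.
  suff /mulmx1_unit[] : P *m (#|V|%:R^-1 *: P^T) = 1%:M by [].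
  by rewrite -scalemxAr PPT scale_scalar_mx mulVf.
have PTP : P^T *m P = #|V|%:R%:M.
  apply: (can_inj (mulKmx P_unit)).
  by rewrite mulmxA PPT scalar_mxC.
pose D : 'rV[CC]_#|V| := \row_i (#|V|%:R * d (vtx i)).
have AP : A *m P = P *m diag_mx D.
  have -> : A = P *m diag_mx (\row_i d (vtx i)) *m P^T.
    apply/matrixP=> i j; rewrite AE mxE.
    rewrite -(big_ord_enum_val
      (fun J => d J * (chi CC J (vtx i) * chi CC J (vtx j)))).
    apply: eq_bigr => J _; rewrite mul_mx_diag !mxE; ring.
  rewrite -!mulmxA PTP; congr (_ *m _).
  by apply/matrixP=> i j; rewrite mul_mx_scalar !mxE mulrnAr.
pose rs := [seq #|V|%:R * d J | J : V].
have [|m [mP m_le]] := n_ge0_graph_exists Ae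
  (c := count (fun r : CC => 0 <= r) rs).
  exists rs; split=> //; rewrite /eigenvalues_mult (char_poly_diagonalized P_unit AP).
  under eq_bigr do rewrite mxE.
  by rewrite (big_ord_enum_val (fun J => 'X - (#|V|%:R * d J)%:P)) big_map big_enum.
exists m; split=> //; apply: leq_trans m_le _.
rewrite -sum1_count big_map big_enum_cond big_mkcond /=.
(* Sets of size 0 or 1 are counted whatever the sign of their eigenvalue; all others have eigenvalue
   - w < 0. *)
have -> : #|T|.+1 = (\sum_(J : V) ((#|J| == 0%N) + (#|J| == 1%N)))%N.
  rewrite big_split /= -add1n -{1}(bin0 #|T|) -{2}(bin1 #|T|) -!card_draws.
  by rewrite -!sum1dep_card; congr (_ + _)%N; rewrite big_mkcond.
apply: leq_sum => J _; rewrite /d -cards_eq0.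
case: (#|J| == 0%N); first by case: ifP.
case: (#|J| == 1%N); first by case: ifP.
rewrite !mul0r !add0r mulrN mulrCA mulfV // mulr1 oppr_ge0 lern0.
by rewrite gtn_eqF ?andbF.
Qed.

End DistanceGraph.

(** * Numerical estimate and conclusion *)

Lemma expn_le_ffact n v : ((n - v) ^ v <= n ^_ v)%N.
Proof.
rewrite ffact_prod -[v in (_ ^ v)%N]card_ord -prod_nat_const.
by apply: leq_prod => i _; rewrite leq_sub2l // ltnW.
Qed.

(* 2^k (12 k m)^k <= (m - 2k)^(2k) reduces to 24 k^4 <= (k^3 - 2k)^2, which
   fails for k = 5. *)
Lemma bin_cube_ge k : (6 <= k)%N ->
  (2 ^ k * (12 * k * k ^ 3) ^ k <= 'C(k ^ 3, 2 * k) * (2 * k)`!)%N.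
Proof.
move=> k_ge6; rewrite bin_ffact; apply: leq_trans (expn_le_ffact _ _).
rewrite -expnMn expnM leq_exp2r ?(leq_trans _ k_ge6) //.
(* The shift by 6 removes the truncated subtraction and leaves polynomials with nonnegative
   coefficients. *)
have [j ->] : exists j, k = (j + 6)%N by exists (k - 6)%N; rewrite subnK.
have -> : ((j + 6) ^ 3 - 2 * (j + 6) = (j + 6) * (j ^ 2 + 12 * j + 34))%N.
  by rewrite !expnS expn0; nia.
rewrite !expnS !expn0; nia.
Qed.

Theorem theorem1p9 (k : nat) (hk : (2 <= k)%N) :
  exists (n : nat) (e : rel 'I_n), simple_graph e /\
    exists (m : nat) (t : Rdefinitions.R),
      n_ge0_graph_is e m /\ (m <= k ^ 3 + 1)%N /\
      theta_is e t /\ (2%:R ^+ k <= t).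
Proof.
have [k_le5|k_ge6] := leqP k 5.
  have [m [mP m_le]] := n_ge0_empty_graph (2 ^ k).
  exists (2 ^ k)%N, (fun _ _ => false); split; first by split.
  exists m, (2 ^ k)%:R; split=> //; split.
    (* 2^k <= k^3 + 1 for k = 2, ..., 5, case by case. *)
    apply: leq_trans m_le _.
    by case: k hk k_le5 {m mP} => [|[|[|[|[|[|]]]]]].
  by split; [exact/theta_empty_graph/expn_gt0 | rewrite natrX].
set T := 'I_(k ^ 3); have cT : #|T| = (k ^ 3)%N by rewrite card_ord.
have k_gt0 : (0 < k)%N by apply: leq_trans k_ge6.
have w_gt0 : (0 < 2 * k)%N by rewrite muln_gt0.
have w_le : (2 * k <= #|T|)%N by rewrite cT !expnS expn0; nia.
have b_gt0 : 0 < 'C(#|T|, 2 * k)%:R :> R by rewrite ltr0n bin_gt0.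
pose K := krawtchouk R (T := T) (2 * k).
have K_ge (J : {set T}) : - 'C(#|T|, 2 * k)%:R <= 2 ^+ k * K J.
  have f_gt0 : 0 < (2 * k)`!%:R :> R by rewrite ltr0n fact_gt0.
  have := @krawtchouk_rec_ge R #|T| k _ (fun v => krawtchouk R v J) k_gt0 w_le
    (krawtchouk0 _ _) (krawtchouk1 _ _) (fun v _ => krawtchoukSS _ v J).
  rewrite -(ler_pM2l (exprn_gt0 k (ltr0Sn R 1))) mulrA => H.
  rewrite -(ler_pM2r f_gt0); apply: le_trans H.
  rewrite mulrN mulNr lerN2 -!natrM -!natrX -natrM ler_nat cT.
  exact: bin_cube_ge.
case: (@arg_minP _ R {set T} set0 xpredT K isT) => J0 _ J0_min.
(* K sums to 0 over all sets and is positive at [set0], so its minimum is negative and kappa = - K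
   J0 is positive. *)
have KJ0_lt0 : K J0 < 0.
  rewrite ltNge; apply/negP => KJ0_ge0.
  have : 0 < \sum_J K J.
    rewrite (bigD1 set0) //= ltr_pwDl ?sumr_ge0 //.
      by rewrite /K krawtchouk_set0.
    by move=> J _; apply: le_trans KJ0_ge0 (J0_min _ _).
  by rewrite sum_krawtchouk ?ltxx.
exists #|{set T}|, (distance_graph (2 * k)); split.
  exact: distance_graph_simple.
have [m [mP m_le]] := n_ge0_distance_graph T w_gt0.
exists m, (1 + 'C(#|T|, 2 * k)%:R / - K J0); split=> //; split.
  by rewrite addn1 -cT.
split.
  apply: theta_distance_graph => //; rewrite ?oppr_gt0 ?opprK //.
  by move=> J; apply: J0_min.
(* The summand 1 is dropped; [K_ge] at [J0] says that C(m, w) / kappa is already at least 2^k. *)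
apply: le_trans (_ : 'C(#|T|, 2 * k)%:R / - K J0 <= _); last by rewrite lerDr.
rewrite ler_pdivlMr ?oppr_gt0 //; have := K_ge J0; lra.
Qed.
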